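(* For every $n>0$, the $M$-triangle of the core label order of the Hochschild lattice $\mathrm{Hoch}(n)$ is $$M_n(x,y)=(xy-y+1)^{n-2}\Bigl((n+1)\bigl((x-1)y-xy^2\bigr)+(n+x^2)y^2+1\Bigr).$$ (For $n=1$ the identity is read in the field of rational functions in $x,y$.)
   Context: Hochschild lattice. For $n\geq 1$, a triword of length $n$ is a tuple $u=(u_1,\ldots,u_n)$ such that (T1) $u_i\in\{0,1,2\}$ for all $i$; (T2) $u_1\neq 2$; (T3) if $u_i=0$, then $u_j\neq 1$ for all $j>i$. Let $\mathrm{Tri}(n)$ be the set of all triwords of length $n$. The Hochschild lattice is $\mathrm{Hoch}(n)=(\mathrm{Tri}(n),\leq)$ where $\leq$ is the componentwise order. It is known to be a semidistributive lattice: the join is the componentwise maximum, and the meet is obtained by taking the componentwise minimum and then replacing by $0$ every entry $1$ that has an entry $0$ somewhere to its left. Core label order. Let $L$ be a finite semidistributive lattice. For a cover relation $a\lessdot b$ put $\lambda(a,b)=\min\{c\in L\mid a\vee c=b\}$; this minimum exists and is join irreducible. The nucleus of $a\in L$ is $a_\downarrow=a\wedge\bigwedge_{b\lessdot a}b$. The core label set of $a$ is $\Psi(a)=\{\lambda(b,b')\mid a_\downarrow\leq b\lessdot b'\leq a\}$. The map $a\mapsto\Psi(a)$ is injective. The core label order $\mathrm{CLO}(L)$ is the poset $(L,\sqsubseteq)$ where $a\sqsubseteq b$ if and only if $\Psi(a)\subseteq\Psi(b)$. $M$-triangle. The poset $\mathrm{CLO}(\mathrm{Hoch}(n))$ is graded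 with least element $(0,\ldots,0)$; let $\mathrm{rk}$ be its rank function (so $\mathrm{rk}(0,\ldots,0)=0$) and $\mu_n$ its Möbius function (with $\mu_n(u,v)=0$ if $u\not\sqsubseteq v$). The $M$-triangle is $$M_n(x,y)=\sum_{u,v\in\mathrm{Tri}(n)}\mu_n(u,v)\,x^{\mathrm{rk}(u)}y^{\mathrm{rk}(v)}.$$ *)

(* Defs.v *)
From HB Require Import structures.
From mathcomp Require Import all_boot all_order all_algebra.
From mathcomp Require Import zify.

Set Implicit Arguments.
Unset Strict Implicit.
Unset Printing Implicit Defensive.

Import Order.TTheory GRing.Theory.

Local Open Scope order_scope.

Section FinPoset.
Context {d : Order.disp_t} {P : finPOrderType d}.
Implicit Types (a b c u v w : P) (C : {set P}).

Definition covers a b : bool :=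
  (a < b) && [forall c, ~~ ((a < c) && (c < b))].

Definition is_chain C : bool :=
  [forall a in C, forall b in C, a >=< b].

(* The largest number of steps in a chain ending at u.  On a graded poset this
   is the rank function normalized to 0 at the minimal elements: see [rk_uniq]. *)
Definition rk u : nat :=
  (\max_(C : {set P} | is_chain C && [forall c in C, (c < u)%O]) #|C|)%N.

(* The fuel k bounds the length of the recursion; #|P| is always enough, so that
   [mobius] satisfies the usual recursion: see [mobiusE]. *)
Fixpoint mobius_rec (k : nat) u v : int :=
  if k is k'.+1 then
    if u == v then 1%R
    else if u < v then (- \sum_(w | (u <= w < v)%O) mobius_rec k' u w)%R
    else 0%R
  else 0%R.

Definition mobius u v : int := mobius_rec #|P| u v.

Lemma card_below_lt w v :
  w < v -> (#|[set x : P | (x < w)%O]| < #|[set x : P | (x < v)%O]|)%N.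
Proof.
move=> wv; apply/proper_card/properP; split.
  by apply/subsetP => x; rewrite !inE => /lt_trans; apply.
by exists w; rewrite !inE ?ltxx.
Qed.

Lemma mobius_rec_fuel k1 k2 u v :
  (#|[set x : P | (x < v)%O]| < k1)%N -> (#|[set x : P | (x < v)%O]| < k2)%N ->
  mobius_rec k1 u v = mobius_rec k2 u v.
Proof.
elim: k1 k2 v => [|k1 IH] [|k2] v //= h1 h2.
case: eqP => // _; case: ifP => // _; congr (- _)%R.
by apply: eq_bigr => w /andP[_ /card_below_lt wv]; apply: IH; exact: leq_trans wv _.
Qed.

Lemma mobiusE u v :
  mobius u v =
  if u == v then 1%R
  else if u < v then (- \sum_(w | (u <= w < v)%O) mobius u w)%R
  else 0%R.
Proof.
have lt_card w : (#|[set x : P | (x < w)%O]| < #|P|)%N.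
  by rewrite -cardsT; apply/proper_card/properP; split=> //; exists w; rewrite !inE ?ltxx.
transitivity (mobius_rec #|P|.+1 u v); last by [].
by apply: mobius_rec_fuel; [|apply: leqW].
Qed.

Lemma rk_lt u v : u < v -> (rk u < rk v)%N.
Proof.
move=> uv; have P0 : is_chain (set0 : {set P}) && [forall c in set0, c < u].
  by apply/andP; split; apply/forall_inP => x; rewrite inE.
rewrite /rk (bigop.bigmax_eq_arg set0) //.
case: arg_maxnP => // C /andP[/forall_inP chC /forall_inP Cu] _.
have uC : u \notin C by apply/negP => /Cu; rewrite ltxx.
have -> : #|C|.+1 = #|u |: C| by rewrite cardsU1 uC.
apply: (@leq_bigmax_cond _ _ (fun C : {set P} => #|C|)); apply/andP; split; last first.
  by apply/forall_inP => c; rewrite !inE => /orP[/eqP->//|/Cu cu]; apply: lt_trans uv.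
apply/forall_inP => a; rewrite !inE => /orP[/eqP->|aC].
  apply/forall_inP => b; rewrite !inE => /orP[/eqP->|/Cu bu]; first exact: comparablexx.
  by apply/ge_comparable/ltW.
apply/forall_inP => b; rewrite !inE => /orP[/eqP->|bC].
  by apply/le_comparable/ltW/Cu.
exact: (forall_inP (chC _ aC)).
Qed.

Lemma ex_lower_cover u v : u < v -> exists2 w, (u <= w) & covers w v.
Proof.
move=> uv.
have uP : (u <= u) && (u < v) by rewrite lexx.
case: (@arg_maxnP P u (fun w => (u <= w) && (w < v)) rk uP) => w /andP[uw wv] wmax.
exists w => //; rewrite /covers wv; apply/forallP => c; apply/negP => /andP[wc cv].
have := rk_lt wc; rewrite ltnNge => /negP; apply; apply: wmax.
by rewrite cv (le_trans uw (ltW wc)).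
Qed.

Lemma rk_uniq (f : P -> nat) :
  (forall u, (forall v, ~~ (v < u)) -> f u = 0%N) ->
  (forall u v, covers u v -> f v = (f u).+1) ->
  rk =1 f.
Proof.
move=> f0 fS.
have f_lt u v : u < v -> (f u < f v)%N.
  elim: (f v).+1 {-2}v (ltnSn (f v)) => // k IH {}v vk uv.
  have [w uw wv] := ex_lower_cover uv; have fw := fS _ _ wv.
  move: uw; rewrite le_eqVlt => /orP[/eqP->|uw]; first by rewrite fw.
  by have := IH w ltac:(lia) uw; lia.
move=> u; apply/eqP; rewrite eqn_leq; apply/andP; split.
  apply/bigmax_leqP => C /andP[/forall_inP chC /forall_inP Cu].
  have h c : c \in C -> (f c < f u)%N by move=> /Cu /f_lt.
  pose g c : 'I_(f u).+1 := inord (f c).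
  have ginj : {in C &, injective g}.
    move=> a b aC bC /(congr1 (@nat_of_ord _)).
    rewrite !inordK ?ltnS; [|exact/ltnW/h|exact/ltnW/h] => fab.
    have := forall_inP (chC a aC) b bC.
    rewrite /Order.comparable => /orP[]; rewrite le_eqVlt => /orP[/eqP//|/f_lt]; lia.
  rewrite -(card_in_imset ginj) -ltnS -[X in (_ < X)%N]card_ord -cardsT.
  apply/proper_card/properP; split=> //; exists ord_max; rewrite ?inE //.
  apply/negP => /imsetP[c cC /(congr1 (@nat_of_ord _))] /=.
  by have fc := h c cC; rewrite inordK ?ltnS; [lia|exact: ltnW].
elim: (f u).+1 {-2}u (ltnSn (f u)) => // k IH {}u uk.
case: (boolP [exists v, v < u]) => [/existsP[v vu]|/existsPn h]; last by rewrite f0.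
have [w _ wu] := ex_lower_cover vu; rewrite (fS _ _ wu).
by apply: leq_ltn_trans (rk_lt (proj1 (andP wu))); apply: IH; have := fS _ _ wu; lia.
Qed.

End FinPoset.

(* 'X is x and 'Y = 'X%:P is y, following polyXY. *)
Definition M_triangle {d} (P : finPOrderType d) : {poly {poly int}} :=
  (\sum_(u : P) \sum_(v : P) (mobius u v)%:~R * 'X ^+ rk u * 'Y ^+ rk v)%R.

HB.mixin Record Lattice_isSemidistributive d T of Order.Lattice d T := {
  join_semidistr : forall x y z : T,
    x `|` y = x `|` z -> x `|` (y `&` z) = x `|` y;
  meet_semidistr : forall x y z : T,
    x `&` y = x `&` z -> x `&` (y `|` z) = x `&` y
}.

#[short(type="finSemidistrLatticeType")]
HB.structure Definition FinSemidistrLattice d :=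
  { T of Order.FinTBLattice d T & Lattice_isSemidistributive d T }.

Section CoreLabels.
Context {d : Order.disp_t} {L : finSemidistrLatticeType d}.
Implicit Types (a b c : L).

(* min {c | a v c = b}; it exists whenever a <= b, see [labelP], so the default
   value \bot is never used in [core_labels]. *)
Definition label a b : L :=
  odflt \bot [pick c | (a `|` c == b) &&
                       [forall c', (a `|` c' == b) ==> (c <= c')]].

Definition nucleus a : L := a `&` \meet_(b | covers b a) b.

Definition core_labels a : {set L} :=
  [set label p.1 p.2 | p : L * L
    & [&& nucleus a <= p.1, covers p.1 p.2 & p.2 <= a]].

Lemma labelP a b : a <= b ->
  a `|` label a b = b /\ forall c, a `|` c = b -> label a b <= c.
Proof.
move=> ab; rewrite /label; case: pickP => [c /andP[/eqP ac /forallP cmin]|] /=.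
  by split=> // c' /eqP ac'; exact: (implyP (cmin c')).
have bP : a `|` b == b by rewrite join_r.
case: (@arg_minnP _ b (fun c => a `|` c == b) rk bP) => m /eqP am mmin.
move/(_ m)/negP; case; rewrite am eqxx; apply/forallP => c; apply/implyP => /eqP ac.
have amc : a `|` (m `&` c) == b by rewrite join_semidistr am ?ac.
have := leIl m c; rewrite le_eqVlt => /orP[/eqP <-|/rk_lt]; first exact: leIr.
by rewrite ltnNge mmin.
Qed.

Lemma core_labels_inj : injective core_labels.
Proof.
suff le_core a b : core_labels a \subset core_labels b -> a <= b.
  by move=> a b ab; apply/le_anti; rewrite !le_core ?ab.
move=> /subsetP sub.
have label_le c x : x \in core_labels c -> x <= c.
  move=> /imsetP[[p q] /=]; rewrite inE /= => /and3P[_ /andP[/ltW pq _] qc] ->.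
  by apply: le_trans qc; have [e _] := labelP pq; rewrite -[leRHS]e leUr.
apply: contraT => nab.
have ltm : a `&` b < a.
  by rewrite lt_neqAle leIl andbT; apply: contra nab => /eqP <-; exact: leIr.
have [w mw wa] := ex_lower_cover ltm.
have [wl lmin] := labelP (ltW (proj1 (andP wa))).
have la : label w a \in core_labels a.
  apply/imsetP; exists (w, a) => //; rewrite inE /= lexx wa !andbT.
  by apply: le_trans (leIr _ _) _; exact: (@meets_inf _ _ _ w).
have lw : label w a <= w.
  by apply: le_trans mw; rewrite lexI (label_le _ _ la) (label_le _ _ (sub _ la)).
by case/andP: wa; rewrite -{1}wl join_l // ltxx.
Qed.

End CoreLabels.

Fact clo_display : Order.disp_t. Proof. by []. Qed.

Definition CLO {d} (L : finSemidistrLatticeType d) : Type := L.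

Section CoreLabelOrder.
Context {d : Order.disp_t} (L : finSemidistrLatticeType d).

HB.instance Definition _ := Finite.on (CLO L).

Definition clo_le : rel (CLO L) :=
  fun a b => core_labels (a : L) \subset core_labels (b : L).

Fact clo_le_refl : reflexive clo_le. Proof. by move=> a; exact: subxx. Qed.

Fact clo_le_anti : antisymmetric clo_le.
Proof. by move=> a b ab; apply/core_labels_inj/eqP; rewrite eqEsubset. Qed.

Fact clo_le_trans : transitive clo_le.
Proof. by move=> b a c; exact: subset_trans. Qed.

HB.instance Definition _ := Order.Le_isPOrder.Build clo_display (CLO L)
  clo_le_refl clo_le_anti clo_le_trans.

End CoreLabelOrder.

Section Words.
Context {n : nat}.
Implicit Types (w : n.-tupleprod 'I_3) (i j : 'I_n).

Definition letter w i : nat := tnth w i.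

(* The letter u_1 is the one of index 0; the condition u_1 <> 2 is vacuous for
   the empty word. *)
Definition triword w : bool :=
  [forall i : 'I_n, (i == 0 :> nat) ==> (letter w i != 2)] &&
  [forall i : 'I_n, forall j : 'I_n,
    (letter w i == 0)%N && (i < j)%N ==> (letter w j != 1)%N].

(* The componentwise minimum of two triwords can violate the last condition;
   its normalization is the meet: see [hoch_meetP]. *)
Definition normalize w : n.-tupleprod 'I_3 :=
  [tuple if (letter w i == 1)%N &&
            [exists j : 'I_n, (j < i)%N && (letter w j == 0)%N]
         then ord0 else tnth w i | i < n].

Definition bot_word : n.-tupleprod 'I_3 := [tuple ord0 | i < n].
Definition top_word : n.-tupleprod 'I_3 :=
  [tuple if (i == 0 :> nat) then inord 1 else ord_max | i < n].

Lemma triwordP w : reflect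
  [/\ forall i, i = 0 :> nat -> letter w i <> 2
     & forall i j, letter w i = 0%N -> (i < j)%N -> letter w j <> 1%N]
  (triword w).
Proof.
apply: (iffP andP) => [[/forallP h2 /forallP h3]|[h2 h3]]; split.
- by move=> i i0; have := h2 i; rewrite i0 => /eqP.
- by move=> i j wi ij; have := forallP (h3 i) j; rewrite wi ij => /eqP.
- by apply/forallP => i; apply/implyP => /eqP i0; apply/eqP; exact: h2.
- apply/forallP => i; apply/forallP => j; apply/implyP => /andP[/eqP wi ij].
  by apply/eqP; exact: (h3 i).
Qed.

Lemma letter_lt3 w i : (letter w i < 3)%N. Proof. exact: ltn_ord. Qed.

Lemma le_wordP w1 w2 : reflect (forall i, (letter w1 i <= letter w2 i)%N) (w1 <= w2).
Proof. by rewrite leEtprod; apply: (iffP forallP). Qed.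

Lemma letter_join w1 w2 i : letter (w1 `|` w2) i = maxn (letter w1 i) (letter w2 i).
Proof.
rewrite /letter tnth_join; move: (tnth w1 i) (tnth w2 i) => x y.
by rewrite joinEtotal /Order.max ltEord; case: ltnP; lia.
Qed.

Lemma letter_meet w1 w2 i : letter (w1 `&` w2) i = minn (letter w1 i) (letter w2 i).
Proof.
rewrite /letter tnth_meet; move: (tnth w1 i) (tnth w2 i) => x y.
by rewrite meetEtotal /Order.min ltEord; case: ltnP; lia.
Qed.

Lemma letter_normalize w i : letter (normalize w) i =
  if (letter w i == 1)%N && [exists j : 'I_n, (j < i)%N && (letter w j == 0)%N]
  then 0%N else letter w i.
Proof. by rewrite {1}/letter tnth_mktuple; case: ifP. Qed.

Lemma letter_bot i : letter bot_word i = 0%N.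
Proof. by rewrite /letter tnth_mktuple. Qed.

Lemma letter_top i : letter top_word i = if (i == 0 :> nat) then 1%N else 2.
Proof. by rewrite /letter tnth_mktuple; case: ifP => // _; rewrite inordK. Qed.

Lemma normalize_le w : normalize w <= w.
Proof. by apply/le_wordP => i; rewrite letter_normalize; case: ifP. Qed.

Lemma letter_normalize_neq w i : letter (normalize w) i <> letter w i ->
  letter w i = 1%N /\ exists2 j : 'I_n, (j < i)%N & letter w j = 0%N.
Proof.
rewrite letter_normalize; case: ifP => // /andP[/eqP wi /existsP[j]].
by move=> /andP[ji /eqP wj] _; split=> //; exists j.
Qed.

Lemma letter_normalize_id w i : (forall j : 'I_n, (j < i)%N -> letter w j <> 0%N) ->
  letter (normalize w) i = letter w i.
Proof.
move=> h; apply/eqP; apply/negP => /negP/eqP /letter_normalize_neq[_ [j ji]].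
exact: h.
Qed.

Lemma meet_triword w1 w2 :
  triword w1 -> triword w2 -> triword (normalize (w1 `&` w2)).
Proof.
move=> /triwordP[h _] _; apply/triwordP; split=> [i i0|i j].
  rewrite letter_normalize; case: ifP => // _; rewrite letter_meet.
  by have := h i i0; have := letter_lt3 w1 i; lia.
move: (w1 `&` w2) => w; rewrite !letter_normalize => wi ij.
case: ifP => [//|/negP k w1j]; apply: k; rewrite w1j eqxx /=.
case: ifP wi => [/andP[_ /existsP[k /andP[ki wk]]] _|_ wi]; apply/existsP.
  by exists k; rewrite wk (ltn_trans ki ij).
by exists i; rewrite wi ij eqxx.
Qed.

Lemma le_normalize w1 w2 : triword w1 -> (w1 <= normalize w2) = (w1 <= w2).
Proof.
move=> /triwordP[_ h1]; apply/idP/idP => [h|]; first exact: le_trans (normalize_le _).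
move=> /le_wordP h; apply/le_wordP => i; rewrite letter_normalize.
case: ifP => // /andP[/eqP w2i /existsP[j /andP[ji /eqP w2j]]].
have w1j : letter w1 j = 0%N by have := h j; lia.
by have := h1 _ _ w1j ji; have := h i; lia.
Qed.

Lemma join_triword w1 w2 : triword w1 -> triword w2 -> triword (w1 `|` w2).
Proof.
move=> /triwordP[h1 g1] /triwordP[h2 g2]; apply/triwordP; split=> [i i0|i j].
  by rewrite letter_join; have := h1 i i0; have := h2 i i0; lia.
rewrite !letter_join => wi ij.
by have := g1 i j ltac:(lia) ij; have := g2 i j ltac:(lia) ij; lia.
Qed.

Lemma bot_triword : triword bot_word.
Proof. by apply/triwordP; split=> [i _|i j _ _]; rewrite letter_bot. Qed.

Lemma top_triword : triword top_word.
Proof.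
by apply/triwordP; split=> [i i0|i j]; rewrite !letter_top ?i0 //; case: ifP.
Qed.

Lemma le_bot_word w : bot_word <= w.
Proof. by apply/le_wordP => i; rewrite letter_bot. Qed.

Lemma le_top_word w : triword w -> w <= top_word.
Proof.
move=> /triwordP[h _]; apply/le_wordP => i; rewrite letter_top.
by have := letter_lt3 w i; case: eqP => [/h|_]; lia.
Qed.

End Words.

Record Hoch (n : nat) := TriWord {
  word : n.-tupleprod 'I_3;
  wordP : triword word
}.

HB.instance Definition _ n := [isSub for @word n].
HB.instance Definition _ n := [Finite of Hoch n by <:].

Fact hoch_display : Order.disp_t. Proof. by []. Qed.

HB.instance Definition _ n :=
  [SubChoice_isSubPOrder of Hoch n by <: with hoch_display].

Section Hochschild.
Context {n : nat}.
Implicit Types (u v w : Hoch n) (i j : 'I_n).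

Lemma le_hochP u v :
  reflect (forall i, (letter (word u) i <= letter (word v) i)%N) (u <= v).
Proof. by rewrite -Order.le_val; exact: le_wordP. Qed.

Definition hoch_join u v : Hoch n :=
  TriWord (join_triword (wordP u) (wordP v)).

Definition hoch_meet u v : Hoch n :=
  TriWord (meet_triword (wordP u) (wordP v)).

Fact hoch_meetP u v w : (u <= hoch_meet v w) = (u <= v) && (u <= w).
Proof. by rewrite -Order.le_val /= (le_normalize _ (wordP u)) lexI. Qed.

Fact hoch_joinP u v w : (hoch_join u v <= w) = (u <= w) && (v <= w).
Proof. by rewrite -Order.le_val /= leUx. Qed.

HB.instance Definition _ := Order.POrder_MeetJoin_isLattice.Build _ (Hoch n)
  hoch_meetP hoch_joinP.

Fact hoch_bot_le u : TriWord bot_triword <= u.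
Proof. by rewrite -Order.le_val /= le_bot_word. Qed.

Fact hoch_top_ge u : u <= TriWord top_triword.
Proof. by rewrite -Order.le_val /= le_top_word ?wordP. Qed.

HB.instance Definition _ := Order.hasBottom.Build _ (Hoch n) hoch_bot_le.
HB.instance Definition _ := Order.hasTop.Build _ (Hoch n) hoch_top_ge.

Lemma letter_hoch_join u v i :
  letter (word (u `|` v)) i = maxn (letter (word u) i) (letter (word v) i).
Proof. exact: letter_join. Qed.

Lemma letter_hoch_meet u v i :
  letter (word (u `&` v)) i = letter (normalize (word u `&` word v)) i.
Proof. by []. Qed.

Fact hoch_join_semidistr u v w :
  u `|` v = u `|` w -> u `|` (v `&` w) = u `|` v.
Proof.
move=> e; apply/le_anti; rewrite leU2 ?leIl //= leUx leUl /=.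
apply/le_hochP => i; rewrite letter_hoch_join letter_hoch_meet letter_normalize.
have ei : maxn (letter (word u) i) (letter (word v) i)
        = maxn (letter (word u) i) (letter (word w) i).
  by rewrite -!letter_hoch_join e.
have [_ hv] := triwordP _ (wordP v); have [_ hw] := triwordP _ (wordP w).
case: ifP => [/andP[/eqP mi /existsP[j /andP[ji /eqP mj]]]|_].
  move: mi mj; rewrite !letter_meet => mi mj.
  have [vj|wj] : letter (word v) j = 0%N \/ letter (word w) j = 0%N by lia.
    by have := hv _ _ vj ji; lia.
  by have := hw _ _ wj ji; lia.
by rewrite letter_meet; lia.
Qed.

Fact hoch_meet_semidistr u v w :
  u `&` v = u `&` w -> u `&` (v `|` w) = u `&` v.
Proof.
move=> e; apply/le_anti; apply/andP; split; last by rewrite leI2 ?leUl.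
rewrite lexI leIl /=.
have := leIl u (v `|` w); have := leIr (v `|` w) u.
move: (u `&` (v `|` w)) => z /le_hochP zvw /le_hochP zu.
apply/le_hochP => i; rewrite leqNgt; apply/negP => vz.
have [_ hz] := triwordP _ (wordP z).
pose p := word u `&` word v; pose q := word u `&` word w.
have pE j : letter p j = minn (letter (word u) j) (letter (word v) j).
  exact: letter_meet.
have qE j : letter q j = minn (letter (word u) j) (letter (word w) j).
  exact: letter_meet.
have pq j : letter (normalize p) j = letter (normalize q) j.
  by rewrite /p /q -!letter_hoch_meet e.
have {}zvw j : (letter (word z) j <=
                maxn (letter (word v) j) (letter (word w) j))%N.
  by rewrite -letter_hoch_join.
have [qi [j ji qj]] : letter q i = 1%N /\ exists2 j : 'I_n, (j < i)%N & letter q j = 0%N.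
  apply: letter_normalize_neq => nqi.
  have /le_wordP/(_ i) := normalize_le p.
  by have := zvw i; have := zu i; rewrite pq nqi pE qE; lia.
have P0 : (letter p j == 0)%N || (letter q j == 0)%N by rewrite qj orbT.
case: (@arg_minnP _ j (fun j => (letter p j == 0)%N || (letter q j == 0)%N)
  (@nat_of_ord n) P0) => l pql lmin.
have lj := lmin _ P0.
have nz (k : 'I_n) : (k < l)%N -> letter p k <> 0%N /\ letter q k <> 0%N.
  move=> kl; split=> k0.
    by have := lmin k; rewrite k0 eqxx /= leqNgt kl => /(_ isT).
  by have := lmin k; rewrite k0 eqxx orbT leqNgt kl => /(_ isT).
have npl : letter (normalize p) l = letter p l.
  by apply: letter_normalize_id => k /nz[].
have nql : letter (normalize q) l = letter q l.
  by apply: letter_normalize_id => k /nz[].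
have li : (l < i)%N := leq_ltn_trans lj ji.
have zi : letter (word z) i = 1%N by have := qE i; have := zu i; have := zvw i; lia.
have zl : letter (word z) l <> 0%N by move=> zl; exact: hz zl li zi.
by have := pq l; have := pE l; have := qE l; have := zu l; have := zvw l; lia.
Qed.

HB.instance Definition _ := Lattice_isSemidistributive.Build _ (Hoch n)
  hoch_join_semidistr hoch_meet_semidistr.

End Hochschild.

(* Main.v *)
(* A triword u is determined by the set S of positions of its letters 2 and the
   position o of its last letter 1, if any.  Its core labels are the words
   0..020..0 for the positions in S, and the words 1^k 0..0 for the positions k
   such that the last position up to k outside S is o.  Hence, writing r_T(i) for
   the last position up to i outside T, (S, o) lies below (T, p) iff S is
   contained in T and either there is no o, or p = r_T(o).  Since
   r_T(r_R(k)) = r_T(k) for R contained in T, the sums defining the Moebius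
   function reduce to alternating sums over boolean intervals [S, T]: its values
   are (-1)^|T\S|, times -#{k not in S | r_T(k) = j} when passing from a word
   without 1 to one whose last 1 is at j.  Summing over o and p for fixed S and T
   leaves (-1)^|T\S| x^|S| y^|T| (1 + (xy - y)(n - |S|)), and the sum over S and T
   is evaluated by expanding products over the positions. *)
Require Import Defs.
From mathcomp Require Import all_boot all_order all_algebra.
From mathcomp Require Import zify ring.

Set Implicit Arguments.
Unset Strict Implicit.
Unset Printing Implicit Defensive.

Import Order.TTheory GRing.Theory.

Local Open Scope ring_scope.

(** * Covers, nuclei and core labels in the Hochschild lattice *)

Section HochCoreLabels.
Context {n : nat}.
Implicit Types (a b c u v w : Hoch n) (i j k l : 'I_n) (x y : bool) (f : 'I_n -> nat).

Notation "u @_ i" := (letter (word u) i) (at level 8, i at level 2).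

Lemma hochP u v : (forall i, u@_i = v@_i) -> u = v.
Proof.
by move=> e; apply/le_anti/andP; split; apply/le_hochP => i; rewrite e.
Qed.

Lemma hoch_lt3 u i : (u@_i < 3)%N. Proof. exact: letter_lt3. Qed.

Lemma hoch_first u i : i = 0%N :> nat -> u@_i <> 2.
Proof. by have /triwordP[+ _] := wordP u; apply. Qed.

Lemma hoch_after0 u i j : u@_i = 0%N -> (i < j)%N -> u@_j <> 1%N.
Proof. by have /triwordP[_] := wordP u; apply. Qed.

Lemma le_letter u v i : (u <= v)%O -> (u@_i <= v@_i)%N.
Proof. by move/le_hochP. Qed.

(** A letter function that is no triword gives bottom; this happens for [jirr true k] at index 0,
    whence the side conditions [k != 0] below. *)
Definition hoch_of f : Hoch n :=
  insubd (\bot%O : Hoch n) [tuple inord (f i) | i < n].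

Lemma letter_hoch_of f :
  (forall i, (f i < 3)%N) -> (forall i, i = 0%N :> nat -> f i <> 2) ->
  (forall i j, f i = 0%N -> (i < j)%N -> f j <> 1%N) ->
  forall i, (hoch_of f)@_i = f i.
Proof.
move=> f3 f0 f1.
have fE i : letter [tuple inord (f i) | i < n] i = f i.
  by rewrite /letter tnth_mktuple inordK.
move=> i; rewrite [word _]insubdK ?fE //; apply/triwordP.
by split=> [j|j k]; rewrite !fE; [exact: f0|exact: f1].
Qed.

Definition differ_at k a b :=
  (a@_k < b@_k)%N /\ forall j, j <> k -> a@_j = b@_j.

Lemma differ_at_lt k a b : differ_at k a b -> (a < b)%O.
Proof.
move=> [abk e]; rewrite lt_neqAle; apply/andP; split.
  by apply/eqP => ab; rewrite ab ltnn in abk.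
by apply/le_hochP => j; case: (eqVneq j k) => [->|/eqP/e->//]; exact: ltnW.
Qed.

(** Lower [b] to the letter of [a] at the last index [k] where they differ. Beyond [k] the two words
    agree, so no 1 ends up behind a new 0: the result is a triword in [a, b), hence equal to [a]. *)
Lemma covers_differ a b : covers a b -> exists k, differ_at k a b.
Proof.
move=> /andP[ab /forallP nbetw]; have le_ab := ltW ab.
have [k0 k0P] : exists k, (a@_k < b@_k)%N.
  apply/existsP; apply: contraTT ab => /existsPn h; suff -> : a = b by rewrite ltxx.
  by apply/hochP => i; have := h i; have := le_letter i le_ab; lia.
case: (@arg_maxnP _ k0 (fun k => (a@_k < b@_k)%N) (@nat_of_ord n) k0P) => k kP kmax.
pose f j := if j == k then a@_k else b@_j.
have fE j : (hoch_of f)@_j = f j.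
  apply: letter_hoch_of; rewrite /f => {j}.
  - by move=> j; case: ifP => _; exact: hoch_lt3.
  - by move=> j j0; case: ifP => [/eqP <-|_]; exact: hoch_first.
  move=> i j; case: eqP => [->|ik]; case: eqP => [->|jk]; rewrite ?ltnn //.
  - move=> ak kj bj; have aj := hoch_after0 ak kj.
    by have := kmax j; have := le_letter j le_ab; lia.
  - move=> bi ij; apply: hoch_after0 ij; have := le_letter i le_ab; lia.
  - exact: hoch_after0.
exists k; split=> // j jk.
have cb : (hoch_of f < b)%O.
  apply: (@differ_at_lt k); split=> [|i ik]; rewrite fE /f ?eqxx //.
  by case: eqP.
have ac : (a <= hoch_of f)%O.
  by apply/le_hochP => i; rewrite fE /f; case: eqP => [->//|_]; exact: le_letter.
have := nbetw (hoch_of f); rewrite cb andbT lt_neqAle ac andbT negbK => /eqP ->.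
by rewrite fE /f; case: eqP.
Qed.

(** A jump from 0 to 2 is a cover when an earlier 0 of [b] rules out the intermediate letter 1. *)
Lemma differ_covers k a b : differ_at k a b ->
  b@_k = (a@_k).+1 \/ (exists2 j : 'I_n, (j < k)%N & b@_j = 0%N) -> covers a b.
Proof.
move=> ab h; rewrite /covers (differ_at_lt ab); apply/forallP => c.
apply/negP => /andP[ac cb]; have [abk e] := ab.
have le_ac j := le_letter j (ltW ac); have le_cb j := le_letter j (ltW cb).
have ec j : j <> k -> c@_j = a@_j /\ c@_j = b@_j.
  by move=> jk; have := e j jk; have := le_ac j; have := le_cb j; lia.
have [ck|ck] : c@_k = a@_k \/ c@_k <> a@_k by lia.
  suff ca : c = a by rewrite ca ltxx in ac.
  by apply/hochP => j; case: (eqVneq j k) => [->//|/eqP/ec[]].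
have [ck'|ck'] : c@_k = b@_k \/ c@_k <> b@_k by lia.
  suff ca : c = b by rewrite ca ltxx in cb.
  by apply/hochP => j; case: (eqVneq j k) => [->//|/eqP/ec[]].
case: h => [h|[j jk bj]]; first by have := le_ac k; have := le_cb k; lia.
have cj : c@_j = 0%N.
  by rewrite -bj; apply: (ec j _).2 => jk'; rewrite jk' ltnn in jk.
by have := hoch_after0 cj jk; have := le_ac k; have := le_cb k; have := hoch_lt3 b k; lia.
Qed.

(* The join irreducibles: 1^{k+1} 0...0 for [x = false] and 0...0 2 0...0, with
   the 2 at index [k > 0], for [x = true]. *)
Definition jirr (x : bool) k : Hoch n :=
  hoch_of (fun j => (if x then (j == k) * 2 else j <= k)%N).

Lemma letter_jirr1 k j : (jirr false k)@_j = (j <= k)%N.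
Proof.
by apply: letter_hoch_of => [i|i _|i l] /=; lia.
Qed.

Lemma letter_jirr2 k j : (k != 0%N :> nat) -> (jirr true k)@_j = ((j == k) * 2)%N.
Proof.
move=> k0; apply: letter_hoch_of => [i|i i0|i l _ _] /=; try by case: eqP.
by case: eqP => // ik; rewrite -ik i0 in k0.
Qed.

Lemma jirr_inj k l x y : (x -> k != 0%N :> nat) -> (y -> l != 0%N :> nat) ->
  jirr x k = jirr y l -> x = y /\ k = l.
Proof.
case: x; case: y => hx hy e.
- have := letter_jirr2 k (hx isT); rewrite e letter_jirr2 ?hy // eqxx.
  by case: eqP.
- have := letter_jirr2 k (hx isT); rewrite e letter_jirr1 eqxx; lia.
- have := letter_jirr2 l (hy isT); rewrite -e letter_jirr1 eqxx; lia.
- split=> //; apply/val_inj => /=.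
  have := letter_jirr1 k l; rewrite e letter_jirr1.
  by have := letter_jirr1 l k; rewrite -e letter_jirr1; lia.
Qed.

Lemma letter_before1 a j k : a@_k = 1%N -> (j <= k)%N -> (0 < a@_j)%N.
Proof.
move=> ak; rewrite leq_eqVlt => /orP[/eqP/val_inj->|jk]; first by rewrite ak.
by rewrite lt0n; apply/eqP => /hoch_after0 /(_ jk).
Qed.

(** As [a] is smaller at [k], any [c] whose join with [a] is [b] has the letter of [b] there. If
    this letter is 1, neither [c] nor [b] has a 0 before [k]: so [c] lies above 1^{k+1} 0...0, and
    that word does join [a] to [b]. *)
Lemma label_differ k a b : differ_at k a b ->
  label a b = jirr (b@_k == 2) k.
Proof.
move=> ab; have [abk e] := ab.
have [lj lmin] := labelP (ltW (differ_at_lt ab)).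
have ck c : (a `|` c)%O = b -> c@_k = b@_k.
  by move=> ac; have := letter_hoch_join a c k; rewrite ac; lia.
apply/le_anti/andP; split.
  apply: lmin; apply: hochP => j; rewrite letter_hoch_join.
  have [bk|bk] := eqVneq b@_k 2.
    have k0 : k != 0%N :> nat by apply/eqP => /hoch_first /(_ bk).
    rewrite letter_jirr2 //; have [->|/eqP/e] := eqVneq j k; first by rewrite bk; lia.
    by lia.
  have {}bk : b@_k = 1%N by have := hoch_lt3 b k; lia.
  rewrite letter_jirr1; have [->|/eqP jk] := eqVneq j k; first by rewrite leqnn; lia.
  have := e j jk; case: (leqP j k) => [/(letter_before1 bk)|_]; lia.
apply/le_hochP => j; move/ck: lj => lk.
have [bk|bk] := eqVneq b@_k 2.
  have k0 : k != 0%N :> nat by apply/eqP => /hoch_first /(_ bk).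
  by rewrite letter_jirr2 //; case: eqP => // ->; rewrite lk bk.
have {}bk : b@_k = 1%N by have := hoch_lt3 b k; lia.
by rewrite letter_jirr1; case: (leqP j k) => // jk; apply: letter_before1 jk; rewrite lk.
Qed.

Lemma nucleus_le u : (nucleus u <= u)%O.
Proof. exact: leIl. Qed.

Lemma nucleus_le_cover u b : covers b u -> (nucleus u <= b)%O.
Proof. by move=> bu; apply: le_trans (leIr _ _) _; exact: meets_inf. Qed.

(** The 2 drops to 1, or to 0 if an earlier 0 (recorded by [z]) rules out the letter 1. *)
Lemma ex_cover2 u k : u@_k = 2 ->
  exists2 b, covers b u & differ_at k b u.
Proof.
move=> uk.
pose z := [exists j : 'I_n, (j < k)%N && (u@_j == 0%N)].
pose f j := if j == k then (~~ z : nat) else u@_j.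
have fE j : (hoch_of f)@_j = f j.
  apply: letter_hoch_of; rewrite /f => {j}.
  - by move=> j; case: ifP => _; [case: (z)|exact: hoch_lt3].
  - by move=> j j0; case: ifP => _; [case: (z)|exact: hoch_first].
  move=> i j; case: eqP => [->|ik]; case: eqP => [->|jk]; rewrite ?ltnn //.
  - case: (boolP z) => // /existsP[l /andP[lk /eqP ul]] _ kj.
    by apply: hoch_after0 ul _; exact: ltn_trans kj.
  - move=> ui ik'; suff -> : z by [].
    by apply/existsP; exists i; rewrite ik' ui.
  - exact: hoch_after0.
have d : differ_at k (hoch_of f) u.
  split=> [|j jk]; rewrite fE /f ?eqxx ?uk; first by case: (z).
  by case: eqP.
exists (hoch_of f) => //; apply: (differ_covers d); rewrite fE /f eqxx uk.
case: (boolP z) => [/existsP[j /andP[jk /eqP uj]]|_]; last by left.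
by right; exists j.
Qed.

Definition is_last1 u i := u@_i = 1%N /\ forall j, (i < j)%N -> u@_j <> 1%N.

(** Lowering the last 1 to 0 leaves no 1 behind the new 0. *)
Lemma ex_cover1 u i : is_last1 u i ->
  exists2 b, covers b u & differ_at i b u.
Proof.
move=> [ui umax].
pose f j := if j == i then 0%N else u@_j.
have fE j : (hoch_of f)@_j = f j.
  apply: letter_hoch_of; rewrite /f => {j}.
  - by move=> j; case: ifP => _; [|exact: hoch_lt3].
  - by move=> j j0; case: ifP => _; [|exact: hoch_first].
  move=> j k; case: eqP => [->|ij]; case: eqP => [->|ik]; rewrite ?ltnn //.
    by move=> _; exact: umax.
  exact: hoch_after0.
have d : differ_at i (hoch_of f) u.
  split=> [|j ji]; rewrite fE /f ?eqxx ?ui //; by case: eqP.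
by exists (hoch_of f) => //; apply: (differ_covers d); left; rewrite fE /f eqxx.
Qed.

(** Some lower cover lowers each given 2, and some lower cover puts a 0 at [i], after which the
    nucleus can have no 1. *)
Lemma nucleus_le1 u i k : is_last1 u i ->
  ((nucleus u)@_k <= (k < i))%N.
Proof.
move=> ui; have le1 : ((nucleus u)@_k <= 1)%N.
  have := le_letter k (nucleus_le u).
  have [uk|uk] := eqVneq u@_k 2; last by have := hoch_lt3 u k; lia.
  have [b /nucleus_le_cover/(le_letter k) nb [bk _]] := ex_cover2 uk; lia.
case: (ltnP k i) => // ik; have ni : (nucleus u)@_i = 0%N.
  by have [b /nucleus_le_cover/(le_letter i) nb [bk _]] := ex_cover1 ui; case: ui; lia.
move: ik; rewrite leq_eqVlt => /orP[/eqP/val_inj <-|/(hoch_after0 ni)]; lia.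
Qed.

(** The word 1^i 0...0 lies below every lower cover [b] of [u]: either [b] keeps the 1 at [i], which
    excludes earlier zeros, or [b] agrees with [u] before [i]. *)
Lemma nucleus_ge1 u i k : u@_i = 1%N -> (k < i)%N -> ((nucleus u)@_k > 0)%N.
Proof.
move=> ui ki; have k_lt_n : (i.-1 < n)%N by have := ltn_ord i; lia.
pose w := jirr false (Ordinal k_lt_n).
have wE j : w@_j = (j < i)%N by rewrite letter_jirr1 /=; lia.
suff /(le_letter k) : (w <= nucleus u)%O by rewrite wE ki.
rewrite lexI; apply/andP; split.
  by apply/le_hochP => j; rewrite wE; case: (ltnP j i) => // /ltnW; exact: letter_before1.
apply/meetsP => b /covers_differ[m [bm e]]; apply/le_hochP => j; rewrite wE.
case: (ltnP j i) => // ji; have [im|mi] := eqVneq i m; last first.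
  by apply: letter_before1 (ltnW ji); rewrite e //; apply/eqP.
by rewrite e ?(letter_before1 ui (ltnW ji)) // -im => ij; rewrite ij ltnn in ji.
Qed.

Lemma core_labels2 u k : k != 0%N :> nat ->
  (jirr true k \in core_labels u) = (u@_k == 2).
Proof.
move=> k0; apply/imsetP/eqP => [[[b b'] /=]|uk].
  rewrite inE /= => /and3P[_ /covers_differ[l d] b'u].
  rewrite (label_differ d) => /jirr_inj[//||b'l ->].
    by move=> /eqP b'l; apply/eqP => /hoch_first /(_ b'l).
  have := le_letter l b'u; have := hoch_lt3 u l; move/esym/eqP: b'l; lia.
have [b bu d] := ex_cover2 uk; exists (b, u); last by rewrite (label_differ d) uk.
by rewrite inE /= bu lexx (nucleus_le_cover bu).
Qed.

(** By the two bounds above, the nucleus is 1^i 0...0 if the last 1 of [u] is at [i]. A label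
    1^{k+1} 0...0 comes from a step from 0 to 1 at [k]; being above the nucleus forces [i <= k],
    being below [u] excludes zeros of [u] up to [k]. *)
Lemma core_labels1 u k :
  (jirr false k \in core_labels u) <->
  exists i, [/\ is_last1 u i, (i <= k)%N & forall j, (j <= k)%N -> u@_j <> 0%N].
Proof.
split=> [/imsetP[[b b'] /=]|[i [ui ik unz]]].
  rewrite inE /= => /and3P[nb /covers_differ[l d] b'u].
  rewrite (label_differ d) => /jirr_inj[//||/esym b'l kl].
    by move=> /eqP b'l; apply/eqP => /hoch_first /(_ b'l).
  subst l; have [bk e] := d.
  have {}b'l : b'@_k = 1%N by have := hoch_lt3 b' k; lia.
  have unz j : (j <= k)%N -> (0 < u@_j)%N.
    by move=> /(letter_before1 b'l) h; apply: leq_trans h (le_letter j b'u).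
  have nk : (nucleus u)@_k = 0%N by have := le_letter k nb; lia.
  have u_lt i : u@_i = 1%N -> (i <= k)%N.
    by move=> ui; rewrite leqNgt; apply/negP => /(nucleus_ge1 ui); rewrite nk.
  (* The first letter of [u] is neither 0 nor 2, so [u] contains a 1 and therefore a last one. *)
  have zn : (0 < n)%N by have := ltn_ord k; lia.
  pose z := Ordinal zn.
  have uz : u@_z == 1%N.
    by have := unz z isT; have := @hoch_first u z erefl; have := hoch_lt3 u z; lia.
  case: (@arg_maxnP _ z (fun j => u@_j == 1%N) (@nat_of_ord n) uz) => i /eqP ui imax.
  exists i; split; [split=> // j ij /eqP/imax|exact: u_lt|]; first by lia.
  by move=> j /unz; lia.
(* The cover from 1^k 0...0 to 1^{k+1} 0...0 lies inside the core and carries the required label. *)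
pose b := hoch_of (fun j => (j < k)%N).
have bE j : b@_j = (j < k)%N.
  by apply: letter_hoch_of => [p|p _|p q] /=; lia.
have d : differ_at k b (jirr false k).
  split=> [|j jk]; rewrite bE letter_jirr1 ?ltnn ?leqnn //.
  have : j <> k :> nat by move/val_inj. 
  lia.
apply/imsetP; exists (b, jirr false k); last first.
  by rewrite (label_differ d) letter_jirr1 leqnn.
rewrite inE /=; apply/and3P; split.
- by apply/le_hochP => j; rewrite bE; have := nucleus_le1 j ui; lia.
- by apply: (differ_covers d); left; rewrite letter_jirr1 leqnn bE ltnn.
apply/le_hochP => j; rewrite letter_jirr1; case: (leqP j k) => // /unz; lia.
Qed.

Lemma core_labels_jirr u c : c \in core_labels u ->
  exists x k, (x -> k != 0%N :> nat) /\ c = jirr x k.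
Proof.
move=> /imsetP[[b b'] /=]; rewrite inE /= => /and3P[_ /covers_differ[l d] _] ->.
exists (b'@_l == 2), l; split; last exact: label_differ.
by move=> /eqP b'l; apply/eqP => /hoch_first /(_ b'l).
Qed.

Lemma core_labels_subset u v :
  (core_labels u \subset core_labels v) <->
  (forall k, u@_k = 2 -> v@_k = 2) /\
  (forall k, jirr false k \in core_labels u -> jirr false k \in core_labels v).
Proof.
split=> [/subsetP h|[h2 h1]].
  split=> k; last exact: h.
  move=> uk; have k0 : k != 0%N :> nat by apply/eqP => /hoch_first /(_ uk).
  by apply/eqP; rewrite -core_labels2 //; apply: h; rewrite core_labels2 // uk.
apply/subsetP => c cu; have [[] [k [k0 ck]]] := core_labels_jirr cu; subst c;
  last exact: h1.
by move: cu; rewrite !core_labels2 ?k0 // => /eqP/h2/eqP.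
Qed.

End HochCoreLabels.

(** * Codes of triwords; the core label order and its rank function on codes *)

Section Codes.
Context {m : nat}.
Notation n := m.+1.
Notation code := ({set 'I_n} * option 'I_n)%type.
Implicit Types (u v : Hoch n) (i j k : 'I_n) (S T R : {set 'I_n}) (c d : code).

Notation "u @_ i" := (letter (word u) i) (at level 8, i at level 2).

(** This is r_S(k). Index 0 is the initial candidate, so the maximum makes sense once
    [ord0 \notin S]. *)
Definition run_start S k : 'I_n :=
  [arg max_(j > ord0 | (j <= k)%N && (j \notin S)) j].

Lemma run_startP S k : ord0 \notin S ->
  [/\ (run_start S k <= k)%N, run_start S k \notin S
    & forall j, (run_start S k < j <= k)%N -> j \in S].
Proof.
move=> S0; rewrite /run_start; case: arg_maxnP => [//|i /andP[ik iS] imax].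
split=> // j /andP[ij jk]; apply: contraTT ij => jS.
by rewrite -leqNgt; apply: imax; rewrite jk jS.
Qed.

Lemma run_start_uniq S k i : ord0 \notin S -> (i <= k)%N -> i \notin S ->
  (forall j, (i < j <= k)%N -> j \in S) -> run_start S k = i.
Proof.
move=> S0 ik iS h; have [rk rS hr] := run_startP k S0.
apply/val_inj => /=; case: (ltngtP (run_start S k) i) => // lt.
  by rewrite hr ?lt ?ik in iS.
by rewrite h ?lt ?rk in rS.
Qed.

Lemma run_start_id S k : ord0 \notin S -> k \notin S -> run_start S k = k.
Proof. by move=> S0 kS; apply: run_start_uniq => // j; lia. Qed.

(** All positions after r_S(k) up to [k] lie in [S], hence in [T], so the search for a position
    outside [T] skips them. *)
Lemma run_start_sub S T k : S \subset T -> ord0 \notin T ->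
  run_start T (run_start S k) = run_start T k.
Proof.
move=> /subsetP ST T0; have S0 : ord0 \notin S by apply: contra T0 => /ST.
have [sk sS hS] := run_startP k S0.
have [ts tT hT] := run_startP (run_start S k) T0.
apply/esym/run_start_uniq => //; first exact: leq_trans ts sk.
move=> j /andP[tj jk]; case: (leqP j (run_start S k)) => [js|sj].
  by apply: hT; rewrite tj.
by apply/ST/hS; rewrite sj.
Qed.

(* A triword is encoded by the set of indices of its letters 2, and the index
   of its last letter 1, if any. *)
Definition valid c : bool :=
  (ord0 \notin c.1) && (if c.2 is Some i then i \notin c.1 else true).

(** Outside the set of 2s, a position before the last 1 cannot hold 0, so it holds 1; one after it
    can only hold 0. *)
Definition decode c : Hoch n :=
  hoch_of (fun k => if k \in c.1 then 2
                    else if c.2 is Some i then (k <= i)%N : nat else 0%N).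

Lemma letter_decode c k : valid c -> (decode c)@_k =
  if k \in c.1 then 2 else if c.2 is Some i then (k <= i)%N : nat else 0%N.
Proof.
case: c => S o /andP[/= S0 oS]; apply: letter_hoch_of => /= [i|i i0|i j].
- by case: ifP => // _; case: o {oS} => // i'; lia.
- have -> : i = ord0 by exact/val_inj.
  by rewrite (negbTE S0); case: o {oS} => // i'; lia.
case: ifP => // _; case: ifP => // _; case: o {oS} => // i'; lia.
Qed.

Lemma decode_surj u : exists2 c, valid c & decode c = u.
Proof.
pose S := [set k | u@_k == 2].
have S0 : ord0 \notin S by rewrite inE; apply/eqP/hoch_first.
case: (boolP [exists k, u@_k == 1%N]) => [/existsP[k0 k0P]|/existsPn nou].
  case: (@arg_maxnP _ k0 (fun k => u@_k == 1%N) (@nat_of_ord n) k0P) => i /eqP ui imax.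
  have cv : valid (S, Some i) by rewrite /valid /= S0 inE ui.
  exists (S, Some i) => //; apply: hochP => k.
  rewrite letter_decode //= inE; case: eqP => [//|uk2].
  have uk3 := hoch_lt3 u k; have := imax k.
  by case: (leqP k i) => [/(letter_before1 ui)|]; case: eqP; lia.
have cv : valid (S, None) by rewrite /valid /= S0.
exists (S, None) => //; apply: hochP => k; rewrite letter_decode //= inE.
by move: (nou k) (hoch_lt3 u k); case: (u@_k) => [|[|[|]]].
Qed.

(** The label needs a last 1 at or before [k] and no 0 up to [k]; then only 2s lie between them, so
    this 1 sits at the last position up to [k] outside the set of 2s. *)
Lemma core_labels_decode1 c k : valid c ->
  (jirr false k \in core_labels (decode c)) <-> c.2 = Some (run_start c.1 k).
Proof.
move=> cv; rewrite core_labels1; have := cv.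
case: c cv => S o cv /andP[/= S0 oS]; split.
  move=> [i [[]]]; rewrite letter_decode //=; case: ifPn => // iS.
  case: o cv oS => // i' cv i'S ii' ilast ik nz.
  have {ii'}ii' : (i <= i')%N by move: ii'; lia.
  have {}ii' : i' = i.
    apply/val_inj/eqP; rewrite eqn_leq ii' andbT leqNgt; apply/negP => /ilast.
    by rewrite letter_decode //= (negbTE i'S) leqnn.
  subst i'; congr Some; apply/esym/run_start_uniq => // j /andP[ij jk].
  by have := nz j jk; rewrite letter_decode //=; case: ifP => // _; lia.
case: o cv oS => // i cv iS [e]; have [ik _ h] := run_startP k S0.
rewrite -e in ik h; exists i; split=> //.
  split=> [|j ij]; rewrite letter_decode //=; first by rewrite (negbTE iS) leqnn.
  by case: ifP => // _; lia.
move=> j jk; rewrite letter_decode //=; case: ifPn => // jS.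
by case: (leqP j i) => // ij; rewrite h ?ij in jS.
Qed.

Definition code_le c d : bool :=
  (c.1 \subset d.1) &&
  (if c.2 is Some i then d.2 == Some (run_start d.1 i) else true).

Lemma decode2 c k : valid c -> (decode c)@_k = 2 <-> k \in c.1.
Proof.
move=> cv; rewrite letter_decode //; split=> [|->//].
by case: ifP => // _; case: c.2 => // i; lia.
Qed.

(** Testing the label at the last 1 [i] is enough: any [k] with r_S(k) = i has r_T(k) = r_T(i) by
    [run_start_sub]. *)
Lemma clo_le_decode c d : valid c -> valid d ->
  @clo_le _ (Hoch n) (decode c) (decode d) = code_le c d.
Proof.
move=> cv dv; have /andP[d0 _] := dv; apply/idP/idP.
  move/core_labels_subset => [h2 h1]; apply/andP; split.
    by apply/subsetP => k; rewrite -!decode2 //; exact: h2.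
  have := h1; have := cv; case: c cv {h1 h2} => S [i|//] cv /andP[/= S0 iS] h1.
  apply/eqP/core_labels_decode1 => //; apply: h1.
  by apply/core_labels_decode1; rewrite //= run_start_id.
move=> /andP[/subsetP sub h]; apply/core_labels_subset; split=> k.
  by rewrite !decode2 //; exact: sub.
rewrite !core_labels_decode1 // => e; move: h; rewrite e => /eqP->.
by rewrite run_start_sub //; apply/subsetP.
Qed.

Lemma code_le_anti c d : valid c -> valid d ->
  code_le c d -> code_le d c -> c = d.
Proof.
case: c => S o; case: d => T p /andP[/= S0 oS] /andP[/= T0 pT].
move=> /andP[/= ST op] /andP[/= TS po].
have {}ST : S = T by apply/eqP; rewrite eqEsubset ST TS.
subst T; congr pair; case: o oS op po => [i iS /eqP-> _|]; first by rewrite run_start_id.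
by case: p pT.
Qed.

(** The default is never taken, because valid codes decode onto all triwords. *)
Definition encode u : code := odflt (set0, None) [pick c | valid c && (decode c == u)].

Lemma encodeP u : valid (encode u) /\ decode (encode u) = u.
Proof.
rewrite /encode; case: pickP => [c /andP[cv /eqP]//|h].
by have [c cv cu] := decode_surj u; have := h c; rewrite cv cu eqxx.
Qed.

Lemma encode_valid u : valid (encode u). Proof. by case: (encodeP u). Qed.
Lemma encodeK : cancel encode decode. Proof. by move=> u; case: (encodeP u). Qed.

Lemma decodeK c : valid c -> encode (decode c) = c.
Proof.
move=> cv; apply: code_le_anti; rewrite ?encode_valid //.
  by rewrite -clo_le_decode ?encode_valid // encodeK; exact: subxx.
by rewrite -clo_le_decode ?encode_valid // encodeK; exact: subxx.
Qed.

Lemma clo_leE (u v : CLO (Hoch n)) : (u <= v)%O = code_le (encode u) (encode v).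
Proof. by rewrite -clo_le_decode ?encode_valid // !encodeK. Qed.

Lemma sum_hoch (V : nmodType) (F : Hoch n -> V) :
  \sum_u F u = \sum_(c | valid c) F (decode c).
Proof.
rewrite (reindex_onto decode encode) => [|u _]; last exact: encodeK.
apply: eq_bigl => c /=; apply/eqP/idP => [<-|/decodeK//]; exact: encode_valid.
Qed.

Lemma sum_code (V : nmodType) (F : code -> V) : \sum_(c | valid c) F c =
  \sum_(S : {set 'I_n} | ord0 \notin S)
    (F (S, None) + \sum_(i | i \notin S) F (S, Some i)).
Proof.
transitivity (\sum_(S : {set 'I_n} | ord0 \notin S)
   \sum_(o | if o is Some i then i \notin S else true) F (S, o)).
  by rewrite pair_big_dep; apply: eq_big => [[S o]|[S o] _].
apply: eq_bigr => S _; rewrite (bigD1 None) //=; congr (_ + _).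
rewrite (reindex_omap Some id) /=; last by case.
by apply: eq_bigl => i; rewrite eqxx !andbT.
Qed.

Definition code_rk c : nat := (#|c.1| + isSome c.2)%N.

Lemma card_set1U S k : k \notin S -> #|k |: S| = #|S|.+1.
Proof. by move=> kS; rewrite cardsU1 kS. Qed.

Lemma clo_rk (u : CLO (Hoch n)) : rk u = code_rk (encode u).
Proof.
apply: (@rk_uniq _ (CLO (Hoch n)) (fun u => code_rk (encode u))) => {u} [u umin|u v].
  (* The word 0...0 is below everything, so it is the only minimal element. *)
  pose b : CLO (Hoch n) := decode (set0, None).
  have v0 : valid (set0, None) by rewrite /valid /= inE.
  have : (b <= u)%O by rewrite clo_leE decodeK // /code_le /= sub0set.
  rewrite le_eqVlt (negbTE (umin b)) orbF => /eqP<-.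
  by rewrite decodeK // /code_rk cards0.
move=> /andP[uv /forallP h].
have between c : valid c -> code_le (encode u) c -> code_le c (encode v) ->
    c = encode u \/ c = encode v.
  move=> cv uc vc; have := h (decode c : CLO (Hoch n)).
  rewrite !lt_neqAle !clo_leE decodeK // uc vc !andbT negb_and !negbK.
  by case/orP => /eqP e; [left; rewrite e|right; rewrite -e]; rewrite decodeK.
have nuv : encode u <> encode v.
  by move=> /(can_inj encodeK) e; rewrite e ltxx in uv.
move: uv; rewrite lt_neqAle clo_leE => /andP[_].
move: nuv between (encode_valid u) (encode_valid v).
case: (encode u) => S o; case: (encode v) => T p nuv between.
move=> /andP[/= S0 oS] /andP[/= T0 pT].
move=> /andP[/= ST op]; rewrite /code_rk /=.
have [e|neST] := eqVneq S T.
  subst T; case: o oS op nuv between => [i iS /eqP-> []|_ _ nuv _].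
    by rewrite run_start_id.
  by case: p nuv pT => // i _ _; rewrite /= addn0 addn1.
have [t tT tS] : exists2 t, t \in T & t \notin S.
  by apply/subsetPn; rewrite eqEsubset ST in neST.
have tT0 : ord0 \notin t |: S.
  by rewrite in_setU1 negb_or S0 andbT; apply: contra T0 => /eqP->.
have tST : t |: S \subset T by rewrite subUset sub1set tT.
(* Adding a single 2 and pushing the last 1 along gives a code above the first and below the second;
   in a cover it must be the second, whose rank is thus one more. *)
pose c : code := (t |: S, omap (run_start (t |: S)) o).
have cv : valid c.
  rewrite /valid /= tT0; case: o {op oS between nuv c} => //= i.
  by case: (run_startP i tT0).
have uc : code_le (S, o) c.
  by rewrite /code_le /= subsetUr; case: o {op oS between nuv c cv} => //=.
have vc : code_le c (T, p).
  rewrite /code_le /= tST; case: o {oS between nuv c cv uc} op => //= i /eqP->.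
  by rewrite run_start_sub.
have [[e _]|[e e']] := between c cv uc vc.
  by move: tS; rewrite -e setU11.
by rewrite -e -e' card_set1U //; case: o {op oS between nuv c cv uc vc e'}.
Qed.

End Codes.

(** * Alternating sums over boolean intervals *)

Lemma sum_interval_prod (R : comPzRingType) (I : finType) (S T : {set I})
    (a b : I -> R) : S \subset T ->
  \sum_(J : {set I} | (S \subset J) && (J \subset T))
    (\prod_(i in J :\: S) a i * \prod_(i in T :\: J) b i) =
  \prod_(i in T :\: S) (a i + b i).
Proof.
move=> /subsetP ST.
(* [F i] is the weight of choosing [i] in [J], [G i] that of leaving it out; the zeros force [J] to
   contain [S] and to stay inside [T]. *)
pose F i := if i \in S then 1 else if i \in T then a i else 0.
pose G i := if i \in S then 0 else if i \in T then b i else 1.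
transitivity (\prod_i (F i + G i)); last first.
  rewrite [RHS]big_mkcond; apply: eq_bigr => i _; rewrite /F /G inE.
  by case: (i \in S); case: (i \in T); rewrite /= ?addr0 ?add0r.
rewrite bigA_distr big_mkcond; apply: eq_bigr => J _.
case: ifPn => [/andP[/subsetP SJ /subsetP JT]|].
  rewrite [X in X * _]big_mkcond [X in _ * X]big_mkcond -big_split /=.
  apply: eq_bigr => i _; rewrite /F /G !inE.
  have := ST i; have := SJ i; have := JT i.
  by case: (i \in S); case: (i \in J); case: (i \in T) => //= h1 h2 h3;
    rewrite ?mulr1 ?mul1r //;
    first [by have := h1 isT | by have := h2 isT | by have := h3 isT].
rewrite negb_and => /orP[] /subsetPn[i]; rewrite /F /G => i1 i2.
  by rewrite (bigD1 i) //= (negbTE i2) i1 mul0r.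
have iS : i \notin S by apply: contra i2 => /ST.
by rewrite (bigD1 i) //= i1 (negbTE iS) (negbTE i2) mul0r.
Qed.

(** With weights -1 and 1 every factor over T\S is zero, so only the empty product survives. *)
Lemma sum_interval_sign (I : finType) (S T : {set I}) : S \subset T ->
  \sum_(J : {set I} | (S \subset J) && (J \subset T)) (-1) ^+ #|J :\: S| =
  (S == T)%:R :> int.
Proof.
move=> ST; rewrite (eq_bigr (fun J : {set I} =>
    \prod_(i in J :\: S) (-1) * \prod_(i in T :\: J) 1)) => [|J _]; last first.
  by rewrite big1_eq mulr1 prodr_const.
rewrite sum_interval_prod // subrr prodr_const expr0n cards_eq0 setD_eq0.
by rewrite eqEsubset ST.
Qed.

Lemma mobius_uniq {d : Order.disp_t} {P : finPOrderType d} (u : P) (g : P -> int) :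
  g u = 1 -> (forall v, (u < v)%O -> \sum_(w | (u <= w <= v)%O) g w = 0) ->
  forall v, (u <= v)%O -> mobius u v = g v.
Proof.
move=> g1 gS v.
elim: (rk v).+1 {-2}v (ltnSn (rk v)) => // k IH {}v vk uv; rewrite mobiusE.
case: eqVneq => [<-//|uv']; have ltuv : (u < v)%O by rewrite lt_neqAle uv' uv.
rewrite ltuv; apply/eqP; rewrite eqr_oppLR -addr_eq0 addrC; apply/eqP.
rewrite -[RHS](gS v ltuv) [RHS](bigD1 v) ?lexx ?uv //=; congr (_ + _).
apply: eq_big => [w|w /andP[uw wv]].
  by rewrite lt_neqAle andbA andbAC.
by apply: IH => //; apply: leq_trans (rk_lt wv) _.
Qed.

(** * The Möbius function of the core label order *)

Section Mobius.
Context {m : nat}.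
Notation n := m.+1.
Notation code := ({set 'I_n} * option 'I_n)%type.
Implicit Types (i j k : 'I_n) (S T R : {set 'I_n}) (c d : code).

(** Meaningful for comparable codes only; [clo_mobius] supplies the value 0 elsewhere. *)
Definition code_mobius c d : int :=
  (-1) ^+ #|d.1 :\: c.1| *
  (if c.2 is None then
     if d.2 is Some j then - #|[set k | (k \notin c.1) && (run_start d.1 k == j)]|%:R
     else 1
   else 1).

Lemma card_setDv S : #|S :\: S| = 0%N. Proof. by rewrite setDv cards0. Qed.

(** Group the [k] counted on the right by i = r_R(k), using r_T(r_R(k)) = r_T(k). *)
Lemma card_run_start R T j : R \subset T -> ord0 \notin T -> forall S,
  \sum_(i | (i \notin R) && (run_start T i == j))
     #|[set k | (k \notin S) && (run_start R k == i)]|%:R =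
  #|[set k | (k \notin S) && (run_start T k == j)]|%:R :> int.
Proof.
move=> RT T0 S; have R0 : ord0 \notin R by apply: contra T0; apply/subsetP.
rewrite -natr_sum -[in RHS]sum1_card; congr _%:R.
rewrite [RHS](partition_big (run_start R)
  (fun i => (i \notin R) && (run_start T i == j))) /=; last first.
  move=> k; rewrite inE => /andP[_]; rewrite run_start_sub // => ->.
  by case: (run_startP k R0) => _ ->.
apply: eq_bigr => i /andP[iR ij]; rewrite -sum1_card; apply: eq_bigl => k.
rewrite !inE; case: (k \in S) => //=; case: eqP => [ki|]; last by rewrite andbF.
by rewrite andbT -(run_start_sub k RT) // ki ij.
Qed.

Lemma code_mobius_sum c d : valid c -> valid d -> code_le c d -> c != d ->
  \sum_(e | valid e && (code_le c e && code_le e d)) code_mobius c e = 0.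
Proof.
case: c => S o; case: d => T p /andP[/= S0 oS] /andP[/= T0 pT].
move=> /andP[/= ST op] necd.
have R0 R : R \subset T -> ord0 \notin R by move/subsetP => h; apply: contra T0 => /h.
rewrite big_mkcondr sum_code /=.
case: o oS op necd => [i iS /eqP-> necd|_ _].
  (* Above each [R] the interval contains exactly one code, with last 1 at r_R(i); the two ends
     differ, so S = T is impossible. *)
  transitivity (\sum_(R : {set 'I_n} | (S \subset R) && (R \subset T))
      (-1) ^+ #|R :\: S| : int).
    rewrite [LHS]big_mkcond [RHS]big_mkcond; apply: eq_bigr => R _.
    rewrite /code_le /= !andbF add0r.
    case: (boolP (R \subset T)) => RT; last first.
      by rewrite andbF; case: ifP => // _; rewrite big1 // => j _; rewrite !andbF.
    rewrite R0 // andbT; case: ifP => SR; last by rewrite big1.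
    have [_ rR _] := run_startP i (R0 _ RT).
    rewrite (bigD1 (run_start R i)) //= eqxx run_start_sub // eqxx.
    rewrite /code_mobius /= mulr1 big1 ?addr0 // => j /andP[_ /negbTE h].
    by rewrite (inj_eq Some_inj) h.
  rewrite sum_interval_sign //; case: eqP => // e; case/eqP: necd.
  by rewrite -e run_start_id.
case: p pT => [j jT _|_ necd].
  pose N : int := #|[set k | (k \notin S) && (run_start T k == j)]|%:R.
  (* Above [R] lie [(R, None)] and the [(R, Some i)] with r_T(i) = j; by [card_run_start] the counts
     of the latter add up to [N], which does not depend on [R]. *)
  transitivity (\sum_(R : {set 'I_n} | (S \subset R) && (R \subset T))
      (-1) ^+ #|R :\: S| * (1 - N) : int).
    rewrite [LHS]big_mkcond [RHS]big_mkcond; apply: eq_bigr => R _.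
    rewrite /code_le /= !andbT.
    case: (boolP (R \subset T)) => RT; last first.
      by rewrite andbF; case: ifP => // _; rewrite big1 ?addr0 // => i _; rewrite !andbF.
    rewrite R0 // andbT; case: ifP => SR; last by rewrite big1 ?addr0.
    rewrite /code_mobius /= mulr1 mulrBr mulr1; congr (_ + _).
    rewrite /N -(card_run_start _ RT) // -mulrN -sumrN mulr_sumr.
    rewrite [RHS]big_mkcondr; apply: eq_bigr => i _.
    by rewrite (inj_eq Some_inj) eq_sym; case: ifP.
  rewrite -mulr_suml sum_interval_sign //; case: eqP => [e|_]; last by rewrite mul0r.
  (* If S = T, only k = j is counted, so N = 1 and the factor 1 - N vanishes. *)
  rewrite mul1r /N e (_ : [set k | _] = [set j]) ?cards1 ?subrr //.
  apply/setP => k; rewrite !inE; apply/andP/eqP => [[kT /eqP<-]|->].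
    by rewrite run_start_id.
  by rewrite jT run_start_id.
transitivity (\sum_(R : {set 'I_n} | (S \subset R) && (R \subset T))
      (-1) ^+ #|R :\: S| : int).
  rewrite [LHS]big_mkcond [RHS]big_mkcond; apply: eq_bigr => R _.
  rewrite /code_le /= !andbT big1 => [|i _]; last by rewrite !andbF.
  rewrite addr0 /code_mobius /= mulr1; case: (boolP (R \subset T)) => RT.
    by rewrite R0.
  by rewrite andbF; case: ifP.
rewrite sum_interval_sign //; case: eqP => // e; case/eqP: necd.
by rewrite e.
Qed.

Lemma clo_mobius (u v : CLO (Hoch n)) : mobius u v =
  if code_le (encode u) (encode v) then code_mobius (encode u) (encode v) else 0.
Proof.
rewrite -clo_leE; case: ifPn => [|nuv]; last first.
  rewrite mobiusE; case: eqVneq => [e|_]; first by rewrite e lexx in nuv.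
  by rewrite lt_neqAle (negbTE nuv) andbF.
move=> uv; pose g (w : CLO (Hoch n)) := code_mobius (encode u) (encode w).
apply: (@mobius_uniq _ _ u g) uv => {v} [|v uv]; rewrite /g.
  have := encode_valid u; case: (encode u) => S [i|] /andP[/= S0 _];
  by rewrite /code_mobius /= card_setDv mulr1.
rewrite big_mkcond (sum_hoch (fun w : CLO (Hoch n) => if (u <= w <= v)%O
  then code_mobius (encode u) (encode w) else 0)).
rewrite -big_mkcondr -[RHS](code_mobius_sum (c := encode u) (d := encode v)).
- apply: eq_big => [c|c /andP[cv _]]; last by rewrite decodeK.
  by case: (boolP (valid c)) => //= cv; rewrite !clo_leE decodeK.
- exact: encode_valid.
- exact: encode_valid.
- by rewrite -clo_leE ltW.
- by apply: contraTneq uv => /(can_inj encodeK)->; rewrite ltxx.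
Qed.

End Mobius.

(** * Evaluation of the sum over pairs of codes *)

Section Evaluation.
Context {m : nat} {R : comNzRingType} (x y : R).
Notation n := m.+1.
Notation code := ({set 'I_n} * option 'I_n)%type.
Implicit Types (i j k : 'I_n) (S T : {set 'I_n}) (c d : code).

Definition code_term c d : R :=
  if code_le c d then (code_mobius c d)%:~R * x ^+ code_rk c * y ^+ code_rk d
  else 0.

Lemma sum_card_run_start S T : ord0 \notin T ->
  \sum_(j | j \notin T) #|[set k | (k \notin S) && (run_start T k == j)]| =
  #|~: S|.
Proof.
move=> T0; rewrite -sum1_card [RHS](partition_big (run_start T) (fun j => j \notin T)) /=.
  apply: eq_bigr => j _; rewrite -sum1_card; apply: eq_bigl => k.
  by rewrite !inE.
by move=> k _; case: (run_startP k T0).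
Qed.

(** Relative to the term without any last 1, each of the n - |S| positions outside [S] contributes
    -y through pairs from [None] to [Some j], and xy through its unique pair [Some i] to
    [Some (run_start T i)]. Pairs from [Some] to [None] are incomparable. *)
Lemma code_term_sum_fixed S T : ord0 \notin T ->
  code_term (S, None) (T, None)
  + \sum_(j | j \notin T) code_term (S, None) (T, Some j)
  + \sum_(i | i \notin S) (code_term (S, Some i) (T, None)
      + \sum_(j | j \notin T) code_term (S, Some i) (T, Some j)) =
  if S \subset T then
    (-1) ^+ #|T :\: S| * x ^+ #|S| * y ^+ #|T| * (1 + (x * y - y) * #|~: S|%:R)
  else 0.
Proof.
move=> T0; rewrite /code_term /code_le /=.
rewrite !andbT; case: (boolP (S \subset T)) => ST /=; last first.
  by rewrite !big1 ?addr0 // => i _; rewrite big1 ?addr0.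
set s := (-1) ^+ #|T :\: S| : int.
have sE : s%:~R = (-1) ^+ #|T :\: S| :> R by rewrite rmorphXn rmorphN1.
rewrite {1}/code_mobius /code_rk /= addn0 -/s mulr1 sE addn0.
have -> : \sum_(j | j \notin T) (code_mobius (S, None) (T, Some j))%:~R *
     x ^+ #|S| * y ^+ (#|T| + 1) =
   (-1) ^+ #|T :\: S| * x ^+ #|S| * y ^+ #|T| * (- y * #|~: S|%:R) :> R.
  rewrite -(sum_card_run_start S T0) natr_sum !mulr_sumr; apply: eq_bigr => j _.
  rewrite /code_mobius /= rmorphM /= -/s sE rmorphN /= rmorph_nat exprD expr1; ring.
have -> : \sum_(i | i \notin S) (0 + \sum_(j | j \notin T)
    (if Some j == Some (run_start T i) then
      (code_mobius (S, Some i) (T, Some j))%:~R * x ^+ (#|S| + 1) * y ^+ (#|T| + 1)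
     else 0)) =
   (-1) ^+ #|T :\: S| * x ^+ #|S| * y ^+ #|T| * (x * y * #|~: S|%:R) :> R.
  rewrite -[#|~: S|]sum1_card natr_sum !mulr_sumr; apply: eq_big => [i|i iS].
    by rewrite inE.
  have [_ rT _] := run_startP i T0.
  rewrite add0r (bigD1 (run_start T i)) //= eqxx big1 => [|j /andP[_ /negbTE h]].
    by rewrite /code_mobius /= mulr1 -/s sE !exprD !expr1; ring.
  by rewrite (inj_eq Some_inj) h.
ring.
Qed.

Lemma code_term_sum :
  \sum_(c | valid c) \sum_(d | valid d) code_term c d =
  \sum_(T : {set 'I_n} | ord0 \notin T) \sum_(S : {set 'I_n} | S \subset T)
    (-1) ^+ #|T :\: S| * x ^+ #|S| * y ^+ #|T| * (1 + (x * y - y) * #|~: S|%:R).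
Proof.
have inS S T : ord0 \notin T -> S \subset T -> ord0 \notin S.
  by move=> T0 /subsetP ST; apply: contra T0; exact: ST.
rewrite sum_code; under eq_bigr => S S0.
  rewrite sum_code; under [X in _ + X]eq_bigr => i iS do rewrite sum_code.
  rewrite exchange_big -big_split /=.
  under eq_bigr => T T0 do rewrite code_term_sum_fixed //.
  over.
rewrite exchange_big /=; apply: eq_bigr => T T0.
rewrite -big_mkcondr; apply: eq_bigl => S.
by case: (boolP (S \subset T)) => [/(inS _ _ T0)->|]; rewrite ?andbF.
Qed.

(** Each position other than 0 is outside [T], in [T] only, or in [S], with weights 1, -y and a_i y.
    The interval expansion is applied to [T] and then to [S]. *)
Lemma sum_nested_prod (a : 'I_n -> R) :
  \sum_(T : {set 'I_n} | ord0 \notin T) \sum_(S : {set 'I_n} | S \subset T)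
    (-1) ^+ #|T :\: S| * \prod_(i in S) a i * y ^+ #|T| =
  \prod_(i | i != ord0) (1 + (a i - 1) * y).
Proof.
transitivity (\prod_(i in [set~ ord0] :\: set0) ((a i - 1) * y + 1)); last first.
  by apply: eq_big => [i|i _]; rewrite ?inE // addrC.
rewrite -sum_interval_prod ?sub0set //; apply: eq_big => [T|T T0].
  rewrite sub0set /=; apply/idP/subsetP => [T0 i iT|h].
    by rewrite !inE; apply: contraNneq T0 => <-.
  by apply/negP => /h; rewrite !inE eqxx.
rewrite big1_eq mulr1 setD0 big_split /= prodr_const -mulr_suml; congr (_ * _).
transitivity (\prod_(i in T :\: set0) (a i + -1)); last by rewrite setD0.
rewrite -sum_interval_prod ?sub0set //; apply: eq_big => [S|S _].
  by rewrite sub0set.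
by rewrite prodr_const setD0 mulrC.
Qed.

Lemma card_neq_ord0 : #|(fun i : 'I_n => i != ord0)| = m.
Proof. exact: etrans (cardC1 ord0) (congr1 predn (card_ord n)). Qed.

Lemma prod_neq_ord0 (a : R) : \prod_(i : 'I_n | i != ord0) a = a ^+ m.
Proof. by rewrite prodr_const card_neq_ord0. Qed.

Lemma sum_nested :
  \sum_(T : {set 'I_n} | ord0 \notin T) \sum_(S : {set 'I_n} | S \subset T)
    (-1) ^+ #|T :\: S| * x ^+ #|S| * y ^+ #|T| = (1 + (x - 1) * y) ^+ m.
Proof.
rewrite -prod_neq_ord0 -sum_nested_prod; apply: eq_bigr => T _.
by apply: eq_bigr => S _; rewrite prodr_const.
Qed.

(** Weight 0 at [k] selects the [S] avoiding [k] and turns its factor into 1 - y. Index 0 has no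
    factor, as [T] avoids it. The extra factor on the left restores the full [m]-th power without
    division. *)
Lemma sum_nested_notin k :
  (1 + (x - 1) * y) *
  \sum_(T : {set 'I_n} | ord0 \notin T) \sum_(S : {set 'I_n} | S \subset T)
    (-1) ^+ #|T :\: S| * x ^+ #|S| * y ^+ #|T| * (k \notin S)%:R =
  (if k == ord0 then 1 + (x - 1) * y else 1 - y) * (1 + (x - 1) * y) ^+ m.
Proof.
pose a i := if i == k then 0 else x.
rewrite (_ : \sum_(T | _) _ = \prod_(i | i != ord0) (1 + (a i - 1) * y)); last first.
  rewrite -sum_nested_prod; apply: eq_bigr => T _; apply: eq_bigr => S _.
  case: (boolP (k \in S)) => kS.
    by rewrite /= (bigD1 k) //= {1}/a eqxx mul0r !(mulr0, mul0r).
  rewrite mulr1 (eq_bigr (fun=> x)) ?prodr_const // => i iS.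
  by rewrite /a; case: eqP => // ik; rewrite -ik iS in kS.
have [e|k0] := eqVneq k ord0.
  congr (_ * _); rewrite -prod_neq_ord0; apply: eq_bigr => i /negbTE i0.
  by rewrite /a e i0.
rewrite -prod_neq_ord0 (bigD1 k) //= [in RHS](bigD1 k) //= /a eqxx.
rewrite (eq_bigr (fun=> 1 + (x - 1) * y)) => [|i /andP[_ /negbTE->] //]; ring.
Qed.

Lemma code_term_sumE :
  (1 + (x - 1) * y) * \sum_(c | valid c) \sum_(d | valid d) code_term c d =
  (1 + (x - 1) * y) ^+ m *
  (n.+1%:R * ((x - 1) * y - x * y ^+ 2) + (n%:R + x ^+ 2) * y ^+ 2 + 1).
Proof.
rewrite code_term_sum.
(* The cardinal of the complement of [S] is spread as a sum of indicators over [k]; index 0 and the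
   [m] other indices then contribute differently. *)
rewrite (_ : \sum_(T | _) _ = (1 + (x - 1) * y) ^+ m + (x * y - y) *
  \sum_k \sum_(T : {set 'I_n} | ord0 \notin T) \sum_(S : {set 'I_n} | S \subset T)
    (-1) ^+ #|T :\: S| * x ^+ #|S| * y ^+ #|T| * (k \notin S)%:R); last first.
  rewrite -sum_nested exchange_big mulr_sumr -big_split /=.
  apply: eq_bigr => T _; rewrite exchange_big mulr_sumr -big_split /=.
  apply: eq_bigr => S _; rewrite -mulr_sumr -natr_sum.
  rewrite (_ : (\sum_k (k \notin S : nat) = #|~: S|)%N); first by ring.
  by rewrite -sum1_card [RHS]big_mkcond; apply: eq_bigr => k _; rewrite inE; case: ifP.
rewrite mulrDr mulrCA mulr_sumr.
under eq_bigr => k _ do rewrite sum_nested_notin.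
rewrite -mulr_suml (bigD1 ord0) //= (eq_bigr (fun=> 1 - y)) => [|k /negbTE-> //].
rewrite sumr_const card_neq_ord0.
rewrite -(mulr_natr _ m) -!natr1; ring.
Qed.

End Evaluation.

(** * Passage to the M-triangle and to rational functions *)

Lemma M_triangle_code (m : nat) : M_triangle (CLO (Hoch m.+1)) =
  \sum_(c | valid c) \sum_(d | valid d) @code_term m _ 'X 'Y c d.
Proof.
rewrite /M_triangle (sum_hoch (fun u : CLO (Hoch m.+1) => \sum_(v : CLO (Hoch m.+1))
   (mobius u v)%:~R * 'X ^+ rk u * 'Y ^+ rk v)).
apply: eq_bigr => c cv.
rewrite (sum_hoch (fun v : CLO (Hoch m.+1) =>
   (mobius (decode c : CLO (Hoch m.+1)) v)%:~R
   * 'X ^+ rk (decode c : CLO (Hoch m.+1)) * 'Y ^+ rk v)).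
apply: eq_bigr => d dv; rewrite clo_mobius !clo_rk !decodeK // /code_term.
by case: ifP => // _; rewrite !mul0r.
Qed.

Theorem theorem6p4 (n : nat) (n_gt0 : (0 < n)%N) :
  let x : {fraction {poly {poly int}}} := tofrac 'X in
  let y : {fraction {poly {poly int}}} := tofrac 'Y in
  tofrac (M_triangle (CLO (Hoch n))) =
    (x * y - y + 1) ^ (n%:Z - 2) *
    (n.+1%:R * ((x - 1) * y - x * y ^+ 2) + (n%:R + x ^+ 2) * y ^+ 2 + 1).
Proof.
case: n n_gt0 => // m _ x y.
set w := x * y - y + 1.
have wE : w = tofrac (1 + ('X - 1) * 'Y).
  by rewrite /w !(rmorphD, rmorphM, rmorphB, rmorph1) -/x -/y; ring.
have w0 : w != 0.
  (* The polynomial takes the value 1 at x = 1. *)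
  rewrite wE tofrac_eq0; apply/eqP => /(congr1 (fun p => p.[1]))/eqP.
  by rewrite !hornerE subrr mul0r addr0 oner_eq0.
(* Multiplying by [w] turns the exponent n - 2, negative for n = 1, into the natural number m = n -
   1. *)
apply: (mulfI w0); rewrite mulrA.
have -> : w * w ^ (m.+1%:Z - 2) = w ^+ m.
  rewrite -{1}(expr1z w) -expfzDr // (_ : 1 + _ = m%:Z) //.
  by rewrite -addn1 PoszD; ring.
rewrite wE -tofracM M_triangle_code code_term_sumE.
rewrite tofracM tofracXn -wE; congr (_ * _).
rewrite !(tofracD, tofracB, tofracM, tofracXn, tofracN, tofrac1, rmorph_nat).
by rewrite -/x -/y; ring.
Qed.
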